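(* Let $t\geq 1$ be an odd integer. For an integer $m\geq 0$ let $P_m$ denote the path with $m$ edges (so $P_0$ is a single vertex), and let $P_0^2P_{t+2}^t$ denote the disjoint union of two copies of $P_0$ and $t$ copies of $P_{t+2}$. Then $$\operatorname{HDE}(P_0^2 P_{t+2}^t;\, P_t)=t+2.$$ Consequently, for every graph $G$ on $n\geq 1$ vertices and all odd positive integers $k\geq t'$ (with $t'$ any odd positive integer), $w_k(G)^{t'}\geq w_{t'}(G)^k$.
   Context: All graphs are finite. A graph homomorphism from $F$ to $G$ is a map $\varphi:V(F)\to V(G)$ such that $\{\varphi(v_1),\varphi(v_2)\}\in E(G)$ for every edge $\{v_1,v_2\}\in E(F)$; $\operatorname{Hom}(F;G)$ is the set of such maps. The homomorphism domination exponent $\operatorname{HDE}(F_1;F_2)$ of graphs $F_1,F_2$ is the maximum real $c$ such that $|\operatorname{Hom}(F_1;G)|\geq|\operatorname{Hom}(F_2;G)|^c$ for every graph $G$. For a graph $G$ on $n$ vertices, $w_k(G)$ denotes the number of walks of length $k$ (i.e., with $k$ edges) in $G$ divided by $n$, equivalently $|\operatorname{Hom}(P_k;G)|/n$. *)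

(* Defs.v *)
From mathcomp Require Import all_boot all_order all_algebra.
From mathcomp Require Import classical_sets reals exp.

Set Implicit Arguments.
Unset Strict Implicit.
Unset Printing Implicit Defensive.

Import Order.TTheory GRing.Theory Num.Theory.

(* Finite simple graphs. The vertex set may be empty. *)
Record sgraph := SGraph {
  svertex :> finType;
  sedge : rel svertex;
  sedge_sym : symmetric sedge;
  sedge_irrefl : irreflexive sedge }.

Section PathGraph.
Variable m : nat.

Definition path_edge : rel 'I_m.+1 :=
  fun i j => (i.+1 == j :> nat) || (j.+1 == i :> nat).

Lemma path_edge_sym : symmetric path_edge.
Proof. by move=> i j; rewrite /path_edge orbC. Qed.

Lemma path_edge_irrefl : irreflexive path_edge.
Proof. by move=> i; rewrite /path_edge orbb; apply/negbTE; rewrite gtn_eqF. Qed.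

(* m counts edges: the path has m.+1 vertices. *)
Definition path_graph : sgraph := SGraph path_edge_sym path_edge_irrefl.
End PathGraph.

Section DisjointUnion.
Variables F1 F2 : sgraph.

Definition union_edge : rel (F1 + F2)%type := fun u v =>
  match u, v with
  | inl x, inl y => sedge x y
  | inr x, inr y => sedge x y
  | _, _ => false
  end.

Lemma union_edge_sym : symmetric union_edge.
Proof. by move=> [x|x] [y|y] //=; apply: sedge_sym. Qed.

Lemma union_edge_irrefl : irreflexive union_edge.
Proof. by move=> [x|x] /=; apply: sedge_irrefl. Qed.

Definition disjoint_union : sgraph := SGraph union_edge_sym union_edge_irrefl.
End DisjointUnion.

Section Copies.
Variables (k : nat) (F : sgraph).

Definition copies_edge : rel ('I_k * F)%type :=
  fun u v => (u.1 == v.1) && sedge u.2 v.2.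

Lemma copies_edge_sym : symmetric copies_edge.
Proof. by move=> u v; rewrite /copies_edge eq_sym sedge_sym. Qed.

Lemma copies_edge_irrefl : irreflexive copies_edge.
Proof. by move=> u; rewrite /copies_edge sedge_irrefl andbF. Qed.

Definition copies : sgraph := SGraph copies_edge_sym copies_edge_irrefl.
End Copies.

Definition Hom (F G : sgraph) : {set {ffun F -> G}} :=
  [set f : {ffun F -> G} | [forall x, forall y, sedge x y ==> sedge (f x) (f y)]].

Local Open Scope ring_scope.

(* powR has the convention 0 `^ c = (c == 0)%:R. *)
Definition HDE_admissible (R : realType) (F1 F2 : sgraph) : set R :=
  fun c => forall G : sgraph,
    powR (#|Hom F2 G|%:R : R) c <= #|Hom F1 G|%:R.

Definition is_HDE (R : realType) (F1 F2 : sgraph) (c : R) : Prop :=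
  HDE_admissible F1 F2 c /\ ubound (HDE_admissible F1 F2) c.

(* Walks v_0, ..., v_k with k edges, vertices and edges possibly repeated. *)
Definition walks (k : nat) (G : sgraph) : {set k.+1.-tuple G} :=
  [set v : k.+1.-tuple G | sorted (@sedge G) v].

Definition walk_density (R : realType) (k : nat) (G : sgraph) : R :=
  #|walks k G|%:R / #|G|%:R.

Lemma card_walks (k : nat) (G : sgraph) : #|walks k G| = #|Hom (path_graph k) G|.
Proof.
pose h (v : k.+1.-tuple G) : {ffun path_graph k -> G} := [ffun i => tnth v i].
have h_inj : injective h.
  by move=> u v /ffunP e; apply: eq_from_tnth => i; move: (e i); rewrite !ffunE.
rewrite -(card_imset _ h_inj); apply: eq_card => f.
apply/imsetP/idP => [[v]|].
  rewrite !inE => sv ->; apply/forallP => i; apply/forallP => j; apply/implyP.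
  have H (a b : 'I_k.+1) : a.+1 == b :> nat -> sedge (tnth v a) (tnth v b).
    move=> /eqP ab; have x0 := tnth v a; rewrite !(tnth_nth x0) -ab.
    by move/sortedP: sv => /(_ x0); apply; rewrite size_tuple ab.
  by rewrite /= !ffunE => /orP[/H//|/H]; rewrite sedge_sym.
rewrite inE => /forallP hf.
pose v : k.+1.-tuple G := [tuple f i | i < k.+1].
have nthv (j : 'I_k.+1) : nth (f ord0) v j = f j by rewrite -tnth_nth tnth_mktuple.
exists v; last by apply/ffunP => i; rewrite ffunE tnth_mktuple.
rewrite inE; apply/(sortedP (f ord0)) => i; rewrite size_tuple => lt.
have := forallP (hf (Ordinal (ltnW lt))) (Ordinal lt) => /implyP.
rewrite -(nthv (Ordinal (ltnW lt))) -(nthv (Ordinal lt)); apply.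
by apply/orP; left; apply/eqP.
Qed.

(* Main.v *)
Require Import Defs.
From mathcomp Require Import all_boot all_order all_algebra.
From mathcomp Require Import classical_sets reals exp.
From mathcomp Require Import ring.

Set Implicit Arguments.
Unset Strict Implicit.
Unset Printing Implicit Defensive.

Import Order.TTheory GRing.Theory Num.Theory.
Local Open Scope ring_scope.

(** Write [h_k] for the number of [k]-walks of [G], [W_k(u)] for the number of
    those starting at [u], and [n] for the number of vertices. For a uniformly
    random [t]-walk [x] and [i < t] put
      [r_i = W_(t-i)(x_i) W_(i+1)(x_(i+1)) / (W_i(x_i) W_(t-i-1)(x_(i+1)))].
    The edge [x_i x_(i+1)] has probability [W_i(x_i) W_(t-i-1)(x_(i+1)) / h_t],
    and splitting a [(t+2)]-walk at its edge number [t-i] shows that [r_i] has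
    mean [h_(t+2) / h_t]. The product of the [r_i] telescopes to
    [W_t(x_0) W_t(x_t)], while [1 / W_t(x_0)] and [1 / W_t(x_t)] have mean at
    most [n / h_t]. These [t+2] positive variables multiply to [1], so by AM-GM
    the product of their means is at least [1]: [n^2 h_(t+2)^t >= h_t^(t+2)].
    The graph [K_2] shows that the exponent is optimal, and iterating the
    inequality in steps of two gives the comparison of walk densities. *)

(** * Weighted sums over walks *)

Section WalkSum.
Variables (R : realFieldType) (G : sgraph).
Implicit Types (u v : G) (k i j : nat) (s : seq G) (F : seq G -> R).

(** [F] receives the [k] vertices after [u], without [u] itself. The recursion on [k] makes
    identities between such sums provable by induction. *)
Fixpoint walk_sum k u F : R :=
  if k is k'.+1 then
    \sum_(v | sedge u v) walk_sum k' v (fun s => F (v :: s))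
  else F [::].

Definition walks_from k u : R := walk_sum k u (fun=> 1).

Local Notation W := walks_from.

Lemma eq_walk_sum k u F1 F2 :
    (forall s, size s = k -> path (@sedge G) u s -> F1 s = F2 s) ->
  walk_sum k u F1 = walk_sum k u F2.
Proof.
elim: k u F1 F2 => [|k IH] u F1 F2 eqF /=; first exact: eqF.
apply: eq_bigr => v uv; apply: IH => s sk sp.
by apply: eqF; rewrite /= ?sk ?uv.
Qed.

Lemma walk_sumD k u F1 F2 :
  walk_sum k u (fun s => F1 s + F2 s) = walk_sum k u F1 + walk_sum k u F2.
Proof.
elim: k u F1 F2 => [|k IH] u F1 F2 //=.
by rewrite -big_split; apply: eq_bigr => v _; rewrite IH.
Qed.

Lemma walk_sumZ k u a F :
  walk_sum k u (fun s => a * F s) = a * walk_sum k u F.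
Proof.
elim: k u F => [|k IH] u F //=.
by rewrite mulr_sumr; apply: eq_bigr => v _; rewrite IH.
Qed.

Lemma walk_sum_const k u a : walk_sum k u (fun=> a) = a * W k u.
Proof. by rewrite -walk_sumZ; apply: eq_walk_sum => *; rewrite mulr1. Qed.

Lemma walk_sum_sum k u (I : finType) (F : I -> seq G -> R) :
  walk_sum k u (fun s => \sum_i F i s) = \sum_i walk_sum k u (F i).
Proof.
elim: k u F => [|k IH] u F //=.
by rewrite exchange_big; apply: eq_bigr => v _; rewrite IH.
Qed.

Lemma walks_fromS k u : W k.+1 u = \sum_(v | sedge u v) W k v.
Proof. by []. Qed.

Lemma walks_from_ge0 k u : 0 <= W k u.
Proof.
elim: k u => [|k IH] u; first exact: ler01.
by rewrite walks_fromS sumr_ge0.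
Qed.

Lemma walk_sum_ge0 k u F :
    (forall s, size s = k -> path (@sedge G) u s -> 0 <= F s) ->
  0 <= walk_sum k u F.
Proof.
elim: k u F => [|k IH] u F F0 /=; first exact: F0.
apply: sumr_ge0 => v uv; apply: IH => s sk sp.
by apply: F0; rewrite /= ?sk ?uv.
Qed.

Lemma walk_sum_gt0 k u F :
    (forall s, size s = k -> path (@sedge G) u s -> 0 < F s) ->
  0 < W k u -> 0 < walk_sum k u F.
Proof.
elim: k u F => [|k IH] u F F0 /=; first by move=> _; apply: F0.
have F0' v : sedge u v -> forall s, size s = k -> path (@sedge G) v s ->
    0 < F (v :: s).
  by move=> uv s sk sp; apply: F0; rewrite /= ?sk ?uv.
move=> W0; have /psumr_neq0P[v _|v /andP[uv Wv]] := elimN eqP (lt0r_neq0 W0).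
  exact: walks_from_ge0.
rewrite (bigD1 v) //=; apply: ltr_pwDl; first by apply: IH Wv; apply: F0'.
apply: sumr_ge0 => v' /andP[uv' _]; apply: walk_sum_ge0 => s sk sp.
exact/ltW/F0'.
Qed.

Lemma walks_from_gt0 k u v : sedge u v -> 0 < W k u.
Proof.
elim: k u v => [|k IH] u v uv; first exact: ltr01.
rewrite walks_fromS (bigD1 v) //= ltr_pwDl //.
  by apply: (IH _ u); rewrite sedge_sym.
by apply: sumr_ge0 => *; apply: walks_from_ge0.
Qed.

(* Summing over the first [i] steps of a walk leaves, by symmetry of the
   adjacency relation, the number of [i]-step walks starting at [x_i]. *)
Lemma sum_walk_sum_drop j i k F :
  \sum_u W j u * walk_sum (i + k) u (fun s => F (drop i (u :: s))) =
  \sum_u W (j + i) u * walk_sum k u (fun s => F (u :: s)).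
Proof.
elim: i j => [|i IH] j; first by rewrite addn0.
rewrite addnS -addSn -IH /=.
under eq_bigr => u _ do rewrite mulr_sumr big_mkcond.
rewrite exchange_big; apply: eq_bigr => v _ /=.
rewrite -big_mkcond walks_fromS mulr_suml.
by apply: eq_big => // u; rewrite sedge_sym.
Qed.

(** Up to normalisation, this is the law of the vertex x_i of a uniformly random [k]-walk: cutting
    there leaves two independent walks out of x_i. *)
Lemma sum_walks_vertex x0 k i (g : G -> R) : (i <= k)%N ->
  \sum_u walk_sum k u (fun s => g (nth x0 (u :: s) i)) =
  \sum_u W i u * W (k - i) u * g u.
Proof.
move=> ik; have := @sum_walk_sum_drop 0 i (k - i) (fun s => g (head x0 s)).
rewrite subnKC // add0n => E.
apply: etrans (etrans _ E) _.
  apply: eq_bigr => u _; rewrite mul1r; apply: eq_walk_sum => s _ _.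
  by rewrite -nth0 nth_drop addn0.
by apply: eq_bigr => u _; rewrite /= walk_sum_const mulrCA mulrC.
Qed.

(** The same cut at an edge gives the joint law of (x_i, x_(i+1)). *)
Lemma sum_walks_edge x0 k i (g : G -> G -> R) : (i < k)%N ->
  \sum_u walk_sum k u
     (fun s => g (nth x0 (u :: s) i) (nth x0 (u :: s) i.+1)) =
  \sum_u \sum_(v | sedge u v) W i u * W (k - i.+1) v * g u v.
Proof.
move=> ik.
have := @sum_walk_sum_drop 0 i (k - i.+1).+1
  (fun s => g (nth x0 s 0) (nth x0 s 1)).
rewrite addnS -addSn subnKC // add0n => E.
apply: etrans (etrans _ E) _.
  apply: eq_bigr => u _; rewrite mul1r; apply: eq_walk_sum => s _ _.
  by rewrite !nth_drop addn0 addn1.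
apply: eq_bigr => u _; rewrite /= mulr_sumr; apply: eq_bigr => v _.
by rewrite walk_sum_const -mulrA (mulrC (g u v)).
Qed.

Lemma sum_walks_from_split k i : (i <= k)%N ->
  \sum_u W k u = \sum_u W i u * W (k - i) u.
Proof.
(* A default vertex for [nth] exists unless [G] is empty, when both sums are empty. *)
move=> ik; case: (pickP (predT : pred G)) => [x0 _|no]; last first.
  by rewrite !big_pred0.
rewrite -[RHS](eq_bigr _ (fun u _ => mulr1 _)).
by rewrite -(sum_walks_vertex x0 (fun=> 1)).
Qed.

(** * The ratios r_i: their mean and their product *)

Definition fold_ratio t x0 (x : seq G) i : R :=
  W (t - i) (nth x0 x i) * W i.+1 (nth x0 x i.+1) /
  (W i (nth x0 x i) * W (t - i.+1) (nth x0 x i.+1)).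

(** The weight of the edge cancels the denominator of the ratio. What remains counts walks of (t -
    i) + 1 + (i + 1) = t + 2 steps through an edge uv, from the two walks leaving its ends. *)
Lemma sum_fold_ratio t x0 i : (i < t)%N ->
  \sum_u walk_sum t u (fun s => fold_ratio t x0 (u :: s) i) =
  \sum_u W (t + 2) u.
Proof.
move=> it; rewrite /fold_ratio.
rewrite (sum_walks_edge x0
  (fun u v => W (t - i) u * W i.+1 v / (W i u * W (t - i.+1) v))) //.
rewrite (@sum_walks_from_split _ (t - i).+1); last first.
  by rewrite addn2 ltnS ltnW // ltnS leq_subr.
have -> : (t + 2 - (t - i).+1)%N = i.+1.
  by rewrite addn2 subSS subSn ?leq_subr // subKn // ltnW.
under [RHS]eq_bigr => v _ do rewrite walks_fromS mulr_suml big_mkcond.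
rewrite [RHS]exchange_big; apply: eq_bigr => u _ /=.
rewrite -big_mkcond; apply: eq_big => [v|v uv]; first by rewrite sedge_sym.
have vu : sedge v u by rewrite sedge_sym.
rewrite mulrC divfK // mulf_neq0 // lt0r_neq0 //.
  exact: walks_from_gt0 uv.
exact: walks_from_gt0 vu.
Qed.

(** Each vertex of a walk of positive length has a neighbour: the next vertex, or the previous one
    at the end. A walk of any length can then bounce along that edge. *)
Lemma path_walks_from_gt0 t x0 u s i k : (0 < t)%N -> size s = t ->
  path (@sedge G) u s -> (i <= t)%N -> 0 < W k (nth x0 (u :: s) i).
Proof.
move=> t0 st /(pathP x0) p it; case: (ltnP i t) => [lit|].
  by apply: walks_from_gt0 (p i _); rewrite st.
case: i it => [|i] it; first by rewrite leqNgt t0.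
move=> _; have := p i; rewrite st => /(_ it) e.
by apply: (@walks_from_gt0 _ _ (nth x0 (u :: s) i)); rewrite sedge_sym.
Qed.

Lemma prod_fold_ratio t x0 u s : (0 < t)%N -> size s = t ->
  path (@sedge G) u s ->
  \prod_(i < t) fold_ratio t x0 (u :: s) i =
  W t (nth x0 (u :: s) 0) * W t (nth x0 (u :: s) t).
Proof.
move=> t0 st p; set x := u :: s.
have Wx k i : (i <= t)%N -> W k (nth x0 x i) != 0.
  by move=> it; apply/lt0r_neq0/(path_walks_from_gt0 x0 k t0 st p it).
(* Two telescoping products, in W_i(x_i) and in 1 / W_(t-i)(x_i). *)
transitivity ((\prod_(i < t) (W i.+1 (nth x0 x i.+1) / W i (nth x0 x i))) *
   \prod_(i < t) (((W (t - i.+1) (nth x0 x i.+1))^-1) /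
                  ((W (t - i) (nth x0 x i))^-1))).
  rewrite -big_split; apply: eq_bigr => i _ /=.
  by rewrite /fold_ratio invfM invrK; ring.
rewrite -(big_mkord predT (fun i => W i.+1 (nth x0 x i.+1) / W i (nth x0 x i))).
rewrite -(big_mkord predT (fun i => (W (t - i.+1) (nth x0 x i.+1))^-1 /
                                    (W (t - i) (nth x0 x i))^-1)).
rewrite (telescope_prodf (f := fun i => W i (nth x0 x i))) //; last first.
  by move=> i /andP[_ /ltnW it]; apply: Wx.
rewrite (telescope_prodf (f := fun i => (W (t - i) (nth x0 x i))^-1)) //; last first.
  by move=> i /andP[_ /ltnW it]; rewrite invr_eq0 Wx.
by rewrite subnn subn0 invrK divr1 invr1 mul1r mulrC.
Qed.

Lemma sum_walks_endpoint t x0 i : (i == 0%N) || (i == t) ->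
  \sum_u walk_sum t u (fun s => (W t (nth x0 (u :: s) i))^-1) <= #|G|%:R.
Proof.
move=> i0t; rewrite (sum_walks_vertex x0 (fun v => (W t v)^-1)); last first.
  by case/orP: i0t => /eqP ->.
rewrite -sum1_card natr_sum; apply: ler_sum => u _.
have -> : W i u * W (t - i) u = W t u.
  by case/orP: i0t => /eqP ->; rewrite ?subn0 ?subnn ?mul1r ?mulr1.
(* A vertex starting no [t]-walk contributes 0 and any other contributes 1, hence only an
   inequality. *)
by have [->|nz] := eqVneq (W t u) 0; rewrite ?mul0r ?ler01 // divff.
Qed.

(** * The AM-GM argument *)

Lemma walks_domination t : (0 < t)%N ->
  (\sum_u W t u) ^+ (t + 2) <=
  #|G|%:R ^+ 2 * (\sum_u W (t + 2) u) ^+ t.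
Proof.
move=> t0; set N := \sum_u W t u; set h := \sum_u W (t + 2) u.
set n : R := #|G|%:R.
have N0 : 0 <= N by apply: sumr_ge0 => u _; apply: walks_from_ge0.
have h0' : 0 <= h by apply: sumr_ge0 => u _; apply: walks_from_ge0.
have [->|Nn0] := eqVneq N 0.
  by rewrite addn2 expr0n /= mulr_ge0 // exprn_ge0 // ler0n.
have Ngt0 : 0 < N by rewrite lt0r Nn0.
have [x0 /= Wx0] : exists u, true && (0 < W t u).
  by apply: psumr_neq0P => [u _|]; [apply: walks_from_ge0|apply/eqP].
have sum_gt0 (F : G -> seq G -> R) :
    (forall u s, size s = t -> path (@sedge G) u s -> 0 < F u s) ->
    0 < \sum_u walk_sum t u (F u).
  move=> F0; rewrite (bigD1 x0) //= ltr_pwDl //.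
    by apply: walk_sum_gt0 => // s; apply: F0.
  by apply: sumr_ge0 => u _; apply: walk_sum_ge0 => s st sp; apply/ltW/F0.
have r_gt0 u s i : size s = t -> path (@sedge G) u s -> (i < t)%N ->
    0 < fold_ratio t x0 (u :: s) i.
  move=> st sp it; have Wx := path_walks_from_gt0 x0 _ t0 st sp.
  by rewrite divr_gt0 // mulr_gt0 // Wx // ltnW.
have h0 : 0 < h.
  rewrite /h -(sum_fold_ratio x0 t0); apply: sum_gt0 => u s st sp.
  exact: r_gt0.
have n0 : 0 < n by rewrite ltr0n; apply/card_gt0P; exists x0.
(* Otherwise AM-GM makes the normalised sum exceed [t + 2] on every walk,
   whereas its average is at most [t + 2]. *)
rewrite leNgt; apply/negP => lt_hN.
(* The factors N / h and N / n bring every mean to at most 1. Index [t] carries the endpoint x_0 and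
   index t + 1 the endpoint x_t. *)
pose E u s (i : nat) : R :=
  if (i < t)%N then N / h * fold_ratio t x0 (u :: s) i
  else N / n * (W t (nth x0 (u :: s) (if i == t then 0%N else t)))^-1.
have E_gt t2 u s : t2 = (t + 2)%N -> size s = t -> path (@sedge G) u s ->
    0 < \sum_(i < t2) E u s i - t2%:R.
  move=> t2E st sp; have Wx k i it := @path_walks_from_gt0 t x0 u s i k t0 st sp it.
  have t2_0 : 0 < t2%:R :> R by rewrite t2E ltr0n addn2.
  have E0 (i : 'I_t2) : i \in 'I_t2 -> 0 <= E u s i.
    move=> _; rewrite /E; case: ifP => it.
      by apply: mulr_ge0; [exact: divr_ge0|exact/ltW/r_gt0].
    apply: mulr_ge0; first by rewrite divr_ge0 // ltW.
    by rewrite invr_ge0; apply/ltW/Wx; case: ifP.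
  have := leif_AGM E0; rewrite card_ord => -[agm _].
  rewrite subr_gt0 ltNge; apply/negP => le_sum.
  (* A sum of at most t + 2 would force a product of at most 1, but the product is N^(t+2) / (n^2
     h^t) on every walk, which [lt_hN] makes larger than 1. *)
  have : \prod_(i < t2) E u s i <= 1.
    apply: (le_trans agm); apply: exprn_ile1.
      by rewrite divr_ge0 ?sumr_ge0 ?ltW.
    by rewrite ler_pdivrMr // mul1r.
  rewrite t2E addn2 !big_ord_recr /= /E ltnn eqxx ltnNge leqnSn /= gtn_eqF //.
  rewrite (eq_bigr (fun i : 'I_t => N / h * fold_ratio t x0 (u :: s) i)); last first.
    by move=> i _; rewrite ltn_ord.
  rewrite big_split prodr_const card_ord prod_fold_ratio //.
  set a := W t _; set b := W t _.
  have a0 : a != 0 by rewrite lt0r_neq0 // Wx.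
  have b0 : b != 0 by rewrite lt0r_neq0 // Wx.
  have -> : (N / h) ^+ t * (a * b) * (N / n / a) * (N / n / b) =
            N ^+ (t + 2) / (n ^+ 2 * h ^+ t).
    rewrite exprD expr_div_n; field.
    by rewrite a0 b0 !lt0r_neq0 // exprn_gt0.
  rewrite ler_pdivrMr ?mul1r; last by rewrite mulr_gt0 // exprn_gt0.
  by rewrite leNgt lt_hN.
(* Summed over all [t]-walks, [E_gt] makes the total exceed (t + 2) N, while each index contributes
   at most N. *)
have := sum_gt0 _ (fun u s => @E_gt _ u s erefl).
under eq_bigr => u _ do rewrite walk_sumD walk_sum_const walk_sum_sum.
rewrite big_split /= exchange_big /= -mulr_sumr -/N mulNr subr_gt0.
apply/negP; rewrite -leNgt.
rewrite (_ : (t + 2)%:R * N = \sum_(i < t + 2) N); last first.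
  by rewrite sumr_const card_ord mulr_natl.
apply: ler_sum => i _; rewrite /E; case it: (i < t)%N.
  rewrite (eq_bigr _ (fun u _ => walk_sumZ t u (N / h)
    (fun s => fold_ratio t x0 (u :: s) i))).
  by rewrite -mulr_sumr sum_fold_ratio // -/h divfK // lt0r_neq0.
rewrite (eq_bigr _ (fun u _ => walk_sumZ t u (N / n)
  (fun s => (W t (nth x0 (u :: s) (if i == t :> nat then 0%N else t)))^-1))).
rewrite -mulr_sumr -[leRHS](divfK (lt0r_neq0 n0)) ler_pM2l ?divr_gt0 //.
by apply: sum_walks_endpoint; case: ifP; rewrite eqxx ?orbT.
Qed.

End WalkSum.

(** * From cardinalities of walks and homomorphisms to walk sums *)

Lemma card_tuple_cons (T : finType) k (P : pred (k.+1.-tuple T)) :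
  #|[set x | P x]| = (\sum_v #|[set s : k.-tuple T | P (cons_tuple v s)]|)%N.
Proof.
rewrite -sum1dep_card.
under [RHS]eq_bigr => v _ do rewrite -sum1dep_card.
rewrite [RHS]pair_big_dep /=.
rewrite (reindex (fun p : T * k.-tuple T => cons_tuple p.1 p.2)) //=.
exists (fun x : k.+1.-tuple T => (thead x, [tuple of behead x])).
  by move=> [v s] _ /=; rewrite theadE; congr pair; apply: val_inj.
by move=> x _; rewrite /= [RHS]tuple_eta; apply: val_inj.
Qed.

Lemma card_paths (R : realFieldType) (G : sgraph) k (u : G) :
  #|[set s : k.-tuple G | path (@sedge G) u s]|%:R = walks_from R k u.
Proof.
elim: k u => [|k IH] u.
  rewrite [RHS]/=.
  by rewrite (_ : [set _ | _] = [set: _]%SET) ?cardsT ?card_tuple //;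
    apply/setP => s; rewrite !inE tuple0.
rewrite card_tuple_cons natr_sum walks_fromS [RHS]big_mkcond.
apply: eq_bigr => v _ /=; case: ifP => uv; first by rewrite -IH.
by rewrite (_ : [set _ | _] = finset.set0) ?cards0 //; apply/setP => s; rewrite !inE.
Qed.

Lemma card_walks_sum (R : realFieldType) (G : sgraph) k :
  #|walks k G|%:R = \sum_u walks_from R k (u : G).
Proof.
rewrite card_tuple_cons natr_sum; apply: eq_bigr => u _.
by rewrite -card_paths.
Qed.

Lemma HomP (F G : sgraph) (f : {ffun F -> G}) :
  reflect (forall x y, sedge x y -> sedge (f x) (f y)) (f \in Defs.Hom F G).
Proof.
rewrite inE; apply: (iffP forallP) => [h x y xy|h x].
  by have /forallP/(_ y)/implyP := h x; apply.
by apply/forallP => y; apply/implyP/h.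
Qed.

Lemma card_Hom_disjoint_union (F1 F2 G : sgraph) :
  #|Defs.Hom (disjoint_union F1 F2) G| = (#|Defs.Hom F1 G| * #|Defs.Hom F2 G|)%N.
Proof.
rewrite -cardsX.
pose h (p : {ffun F1 -> G} * {ffun F2 -> G}) :
    {ffun disjoint_union F1 F2 -> G} :=
  [ffun z => match z with inl x => p.1 x | inr y => p.2 y end].
have h_inj : injective h.
  move=> [f1 f2] [g1 g2] /ffunP e; congr pair; apply/ffunP => x.
    by have := e (inl x); rewrite !ffunE.
  by have := e (inr x); rewrite !ffunE.
rewrite -(card_imset _ h_inj); apply: eq_card => f.
apply/idP/imsetP => [/HomP hf|[[f1 f2]]].
  exists ([ffun x => f (inl x)], [ffun x => f (inr x)]).
    rewrite finset.in_setX; apply/andP; split; apply/HomP => x y xy; rewrite !ffunE;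
    exact: hf.
  by apply/ffunP => -[x|x]; rewrite !ffunE.
rewrite finset.in_setX => /andP[/HomP h1 /HomP h2] ->; apply/HomP.
by move=> [x|x] [y|y] //= xy; rewrite !ffunE /=; [apply: h1|apply: h2].
Qed.

Lemma card_Hom_copies k (F G : sgraph) :
  #|Defs.Hom (copies k F) G| = (#|Defs.Hom F G| ^ k)%N.
Proof.
rewrite -[k in RHS]card_ord -card_ffun_on.
pose h (p : {ffun 'I_k -> {ffun F -> G}}) : {ffun copies k F -> G} :=
  [ffun z => p z.1 z.2].
have h_inj : injective h.
  move=> p q /ffunP e; apply/ffunP => i; apply/ffunP => x.
  by have := e (i, x); rewrite !ffunE.
rewrite -(card_imset _ h_inj); apply: eq_card => f.
apply/idP/imsetP => [/HomP hf|[p /ffun_onP hp ->]].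
  exists [ffun i => [ffun x => f (i, x)]].
    apply/ffun_onP => i; rewrite ffunE; apply/HomP => x y xy; rewrite !ffunE.
    by apply: hf; rewrite /= /copies_edge eqxx.
  by apply/ffunP => -[i x]; rewrite !ffunE.
apply/HomP => -[i x] [j y] /andP[/= /eqP <- xy]; rewrite !ffunE /=.
by have /HomP := hp i; apply.
Qed.

Lemma card_walks0 (G : sgraph) : #|walks 0 G| = #|G|.
Proof.
rewrite card_tuple_cons -sum1_card; apply: eq_bigr => u _.
by rewrite (_ : [set _ | _] = [set: _]%SET) ?cardsT ?card_tuple //;
  apply/setP => s; rewrite !inE tuple0.
Qed.

Lemma card_Hom_paths (G : sgraph) a b c :
  #|Defs.Hom (disjoint_union (copies a (path_graph 0)) (copies b (path_graph c))) G|
  = (#|G| ^ a * #|walks c G| ^ b)%N.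
Proof.
by rewrite card_Hom_disjoint_union !card_Hom_copies -!card_walks card_walks0.
Qed.

Lemma bool_neq_sym : symmetric (fun a b : bool => a != b).
Proof. by move=> a b; rewrite eq_sym. Qed.

Lemma bool_neq_irrefl : irreflexive (fun a b : bool => a != b).
Proof. by move=> a; rewrite eqxx. Qed.

Definition edge_graph : sgraph := SGraph bool_neq_sym bool_neq_irrefl.

(** In K_2 every vertex has one neighbour, so a walk is determined by its start. *)
Lemma card_walks_edge_graph k : #|walks k edge_graph| = 2.
Proof.
apply/eqP; rewrite -(eqr_nat rat) card_walks_sum.
have W1 u : walks_from rat k (u : edge_graph) = 1.
  elim: k u => [//|k IH] u; rewrite walks_fromS (big_pred1 (~~ u)) //.
  by case: u => -[].
by under eq_bigr => u _ do rewrite W1; rewrite sumr_const card_bool.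
Qed.

(** * Walk densities and the final statement *)

Lemma walk_density_ge0 (R : realType) k G : 0 <= walk_density R k G.
Proof. by rewrite divr_ge0 ?ler0n. Qed.

(** Dividing [walks_domination] by n^(k+2) absorbs its factor n^2 and leaves n^k under the
    right-hand side. *)
Lemma walk_density_step (R : realType) (G : sgraph) k : (0 < k)%N ->
  (0 < #|G|)%N ->
  walk_density R k G ^+ (k + 2) <= walk_density R (k + 2) G ^+ k.
Proof.
move=> k0 n0; have := walks_domination R G k0.
rewrite -!card_walks_sum /walk_density !expr_div_n => le.
have n0' : 0 < (#|G|%:R : R) by rewrite ltr0n.
rewrite ler_pdivrMr ?exprn_gt0 // (exprD #|G|%:R); apply: le_trans le _.
by rewrite mulrA divfK ?expf_neq0 ?lt0r_neq0 // mulrC.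
Qed.

Theorem theorem3p2 (R : realType) (t : nat) (ht : odd t) :
  is_HDE
    (disjoint_union (copies 2 (path_graph 0)) (copies t (path_graph (t + 2))))
    (path_graph t) ((t + 2)%:R : R)
  /\ (forall (G : sgraph) (k t' : nat), (0 < #|G|)%N -> odd k -> odd t' ->
        (t' <= k)%N ->
        walk_density R t' G ^+ k <= walk_density R k G ^+ t').
Proof.
split; first split.
- move=> G; rewrite powR_mulrn ?ler0n // card_Hom_paths -card_walks.
  rewrite natrM !natrX !card_walks_sum.
  by apply: walks_domination; case: (t) ht.
(* On K_2 admissibility reads 2^c <= 2^2 * 2^t; logarithms give c <= t + 2. *)
- move=> c /(_ edge_graph).
  rewrite card_Hom_paths -card_walks !card_walks_edge_graph card_bool -expnD.
  rewrite natrX addnC -powR_mulrn ?ler0n //.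
  rewrite -ler_ln ?posrE ?powR_gt0 ?ltr0n // !ln_powR ler_pM2r //.
  by rewrite ln_gt0 // ltr1n.
move=> G k t' n0 ok ot' tk.
have ek : ~~ odd (k - t') by rewrite oddB // ok ot'.
(* Both lengths are odd, so k = 2m + t', and the induction on m goes up in steps of two. *)
rewrite -(subnK tk) -(even_halfK ek); elim: (k - t')./2 => [|m IH].
  by rewrite add0n.
set j := (m.*2 + t')%N in IH *.
have -> : (m.+1.*2 + t' = j + 2)%N by rewrite doubleS addn2.
have j0 : (0 < j)%N by rewrite /j; case: (t') ot' => // ? _; rewrite addnS.
(* After raising to the power j, [IH] to the power j + 2 and [walk_density_step] to the power t'
   chain through w_j^(t'(j+2)). *)
rewrite -(ler_pXn2r j0) ?nnegrE ?exprn_ge0 ?walk_density_ge0 //.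
rewrite -!exprM mulnC exprM (mulnC t') [leRHS]exprM.
have le1 : walk_density R t' G ^+ j ^+ (j + 2) <=
           walk_density R j G ^+ t' ^+ (j + 2).
  by rewrite lerXn2r ?nnegrE ?exprn_ge0 ?walk_density_ge0.
apply: (le_trans le1); rewrite -exprM mulnC exprM.
by rewrite lerXn2r ?nnegrE ?exprn_ge0 ?walk_density_ge0 // walk_density_step.
Qed.
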